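(* Let $A\colon\mathcal{D}(A)\subseteq\mathcal{H}\to\mathcal{K}$ be a closed, densely defined linear operator between Hilbert spaces, let $S=A^*A$ with spectral measure $\mu$, let $Q\colon\mathcal{H}\to\mathcal{K}$ be the partial isometry extending $AS^{-1/2}$, and let $\nu$ be the operator-valued measure $\nu(E)=Q\mu(E)$ for Borel sets $E\subseteq\mathbb{R}$. Then $$A=\int_{[0,\infty)}\lambda^{1/2}\,d\nu(\lambda)$$ (equality of unbounded operators, including equality of domains).
   Context: All Hilbert spaces are separable and complex; $\mathcal{N}$ denotes the kernel. Since $A$ is closed and densely defined, $S=A^*A$ is self-adjoint and nonnegative; let $\mu$ be its spectral (projection-valued) measure on $\mathbb{R}$, so $S=\int_{\mathbb{R}}\lambda\,d\mu(\lambda)$, and write $\mu_x(E)=\langle\mu(E)x,x\rangle$. For Borel $f$, $f(S)=\int f\,d\mu$ with domain $\{x:\int|f|^2d\mu_x<\infty\}$. Let $P$ be the orthogonal projection onto $\mathcal{N}(S)$, and $S^{-1/2}=g(S)$ with $g(\lambda)=\lambda^{-1/2}\mathbf{1}_{(0,\infty)}(\lambda)$. The operator $AS^{-1/2}$ is isometric on $\mathcal{D}(S^{-1/2})\cap\mathcal{N}(S)^\perp$, which is dense in $\mathcal{N}(S)^\perp$; let $\widetilde{Q}\colon\mathcal{N}(S)^\perp\to\mathcal{K}$ be its unique isometric extension, and define the partial isometry $Q\colon\mathcal{H}\to\mathcal{K}$, $Qx=\widetilde{Q}(I-P)x$. Integral with respect to $\nu$: for a nonnegative measurable $f\colon\mathbb{R}\to\mathbb{R}$,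 the operator $\int_{\mathbb{R}}f(\lambda)\,d\nu(\lambda)$ has domain $\mathcal{D}(\nu f)=\{x\in\mathcal{H}:\int_{\mathbb{R}}f(\lambda)^2\,d\mu_{(I-P)x}(\lambda)<\infty\}$ and is given there by $\left(\int_{\mathbb{R}}f\,d\nu\right)x=\lim_{k\to\infty}Qf_k(S)x$, where $\{f_k\}$ is any sequence of nonnegative simple functions increasing pointwise to $f$ (the limit exists and does not depend on the choice of sequence). Also $\int_{[0,\infty)}\lambda^{1/2}\,d\nu(\lambda)$ means $\int_{\mathbb{R}}f\,d\nu$ with $f(\lambda)=\lambda^{1/2}\mathbf{1}_{[0,\infty)}(\lambda)$. *)

(* Defs.v *)
From HB Require Import structures.
From mathcomp Require Import all_boot all_order all_algebra.
From mathcomp Require Import all_classical all_reals all_analysis.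
From mathcomp Require Import complex.

Set Implicit Arguments.
Unset Strict Implicit.
Unset Printing Implicit Defensive.

Import Order.TTheory GRing.Theory Num.Theory.
Import numFieldNormedType.Exports.
Import HBSimple HBNNSimple.

Local Open Scope classical_set_scope.
Local Open Scope ring_scope.
Local Open Scope complex_scope.

(* Inner products are linear in the first argument and conjugate-linear in the
   second one. *)
HB.mixin Record isHilbert (R : realType) (H : Type)
    of CompleteNormedModule R[i] H := {
  inner : {dot H for @Num.conj R[i]} ;
  inner_norm : forall x : H, inner x x = `|x| ^+ 2
}.

#[short(type="hilbertType")]
HB.structure Definition Hilbert (R : realType) :=
  {H of CompleteNormedModule R[i] H & isHilbert R H}.

Definition separable (T : topologicalType) :=
  exists2 D : set T, countable D & dense D.

(* [app] is only meaningful on [domain]: use [op_eq], not Leibniz equality, to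
   compare operators. *)
Record operator (H K : Type) := Operator {
  domain : set H ;
  app :> H -> K
}.

Definition op_eq (H K : Type) (S T : operator H K) :=
  domain S = domain T /\ forall x, domain S x -> S x = T x.

Definition op_comp (H K L : Type) (S : operator K L) (T : operator H K) :
    operator H L :=
  Operator (domain T `&` T @^-1` domain S) (S \o T).

Section operators.
Variables (R : realType) (H K : hilbertType R).
Implicit Types (A : operator H K) (N : set H).

Definition linear_op A :=
  domain A 0 /\
  forall (a : R[i]) x y, domain A x -> domain A y ->
    domain A (a *: x + y) /\ A (a *: x + y) = a *: A x + A y.

Definition graph A : set (H * K) := [set p | domain A p.1 /\ p.2 = A p.1].

Definition closed_op A := closed (graph A).

Definition densely_defined A := dense (domain A).

Definition adjoint_value A (y : K) : set H :=
  [set z | forall x, domain A x -> inner (A x) y = inner x z].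

Definition adjoint A : operator K H :=
  Operator [set y | adjoint_value A y !=set0]
           (fun y => xget 0 (adjoint_value A y)).

Definition kernel A : set H := [set x | domain A x /\ A x = 0].

Definition orthocomplement N : set H :=
  [set x | forall y, N y -> inner x y = 0].

Definition orthogonal_projection N (x : H) : H :=
  xget 0 [set p | N p /\ orthocomplement N (x - p)].

End operators.

Section spectral_calculus.
Variables (R : realType) (H : hilbertType R).
Implicit Types (mu : set (measurableTypeR R) -> H -> H) (f : R -> R).

Definition is_orthogonal_projection (p : H -> H) :=
  [/\ linear p, forall x, p (p x) = p x
    & forall x y, inner (p x) y = inner x (p y)].

Definition projection_valued_measure mu :=
  [/\ forall E, measurable E -> is_orthogonal_projection (mu E),
      mu set0 = (fun=> 0) /\ mu setT = id,
      forall E F, measurable E -> measurable F ->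
        mu (E `&` F) = mu E \o mu F
    & forall (F : (set (measurableTypeR R))^nat) x,
        (forall n, measurable (F n)) -> trivIset setT F ->
        \sum_(0 <= i < n) mu (F i) x @[n --> \oo] --> mu (\bigcup_n F n) x].

(* mu_x(E) = <mu(E) x, x>, which is real because mu(E) is self-adjoint. *)
Definition scalar_measure mu (x : H) (E : set (measurableTypeR R)) : \bar R :=
  (complex.Re (inner (mu E x) x))%:E.

(* The vectors x for which \int f^2 d mu_x is finite. *)
Definition square_integrable mu f : set H :=
  [set x | (\int[scalar_measure mu x]_l (f l ^+ 2)%:E < +oo)%E].

Definition simple_integral (K : hilbertType R)
    (m : set (measurableTypeR R) -> H -> K)
    (s : {sfun measurableTypeR R >-> R}) (x : H) : K :=
  \sum_(a \in range s) a%:C *: m (s @^-1` [set a]) x.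

(* f(S) = \int f d mu for a real Borel function f: its value at x is the common
   limit of s_k(S) x over all sequences of simple functions s_k with
   |s_k| <= |f| that tend to f pointwise. *)
Definition spectral_integral mu f : operator H H :=
  Operator (square_integrable mu f)
    (fun x => xget 0 [set z |
      forall s : nat -> {sfun measurableTypeR R >-> R},
        (forall k l, `|s k l| <= `|f l|) ->
        (forall l, s k l @[k --> \oo] --> f l) ->
        simple_integral mu (s k) x @[k --> \oo] --> z]).

Definition is_spectral_measure (S : operator H H) mu :=
  projection_valued_measure mu /\ op_eq S (spectral_integral mu id).

End spectral_calculus.

Section polar_decomposition.
Variables (R : realType) (H K : hilbertType R).
Implicit Types (A : operator H K) (mu : set (measurableTypeR R) -> H -> H).

Definition gram A : operator H H := op_comp (adjoint A) A.

Definition inv_sqrt (l : R) : R := (Num.sqrt l)^-1 * \1_(`]0, +oo[) l.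

Definition AS_inv_sqrt A mu : operator H K :=
  op_comp A (spectral_integral mu inv_sqrt).

(* Qt is the isometric extension of A S^{-1/2} to N(S)^\perp; its values outside
   N(S)^\perp are irrelevant. *)
Definition is_isometric_extension A mu (Qt : H -> K) :=
  let M := orthocomplement (kernel (gram A)) in
  [/\ forall (a : R[i]) x y, M x -> M y ->
        Qt (a *: x + y) = a *: Qt x + Qt y,
      forall x, M x -> `|Qt x| = `|x|
    & forall x, M x -> domain (AS_inv_sqrt A mu) x ->
        Qt x = AS_inv_sqrt A mu x].

(* The projection P onto N(S). *)
Definition kernel_projection A : H -> H :=
  orthogonal_projection (kernel (gram A)).

Definition partial_isometry A (Qt : H -> K) (x : H) : K :=
  Qt (x - kernel_projection A x).

Definition nu (Q : H -> K) mu (E : set (measurableTypeR R)) : H -> K :=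
  Q \o mu E.

Lemma simple_integral_nu (Q : H -> K) mu s x : linear Q ->
  Q (simple_integral mu s x) = simple_integral (nu Q mu) s x.
Proof.
move=> linQ.
have Q0 : Q 0 = 0.
  by have := linQ (-1) 0 0; rewrite scaler0 addr0 scaleN1r addNr.
have QD : {morph Q : u v / u + v}.
  by move=> u v; rewrite -[u in LHS]scale1r linQ scale1r.
rewrite /simple_integral !fsbig_finite/=; [|exact: fimfunP..].
rewrite (big_morph Q QD Q0); apply: eq_bigr => a _.
by rewrite -[X in Q X]addr0 linQ Q0 addr0.
Qed.

(* For simple s, Q s(S) is the integral of s with respect to nu, by
   simple_integral_nu. *)
Definition nu_integral A mu (Q : H -> K) (f : R -> R) : operator H K :=
  Operator [set x | square_integrable mu f (x - kernel_projection A x)]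
    (fun x => xget 0 [set y |
      forall s : nat -> {nnsfun measurableTypeR R >-> R},
        (forall l, nondecreasing_seq (fun k => s k l)) ->
        (forall l, s k l @[k --> \oo] --> f l) ->
        Q (simple_integral mu (s k) x) @[k --> \oo] --> y]).

Definition sqrt_nneg (l : R) : R := Num.sqrt l * \1_(`[0, +oo[) l.

End polar_decomposition.

(* Main.v *)
Require Import Defs.
From HB Require Import structures.
From mathcomp Require Import all_boot all_order all_algebra.
From mathcomp Require Import all_classical all_reals all_analysis.
From mathcomp Require Import measurable_realfun finmap complex ring lra.

(* Write mu_x for the measure E |-> <mu(E) x, x> = |mu(E) x|^2, so that
   |s(S) x|^2 is the integral of s^2 against mu_x for simple s.

   Domains. If E is bounded then mu(E) x lies in the domain of S and
   |A mu(E) x|^2 = <S mu(E) x, mu(E) x> is the integral of l over E; for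
   E inside the negative half-line this forces mu(E) = 0. Let E_n = [0, n]. If
   the integral of l against mu_x is finite, then A mu(E_n) x is Cauchy while
   mu(E_n) x tends to x, so x is in the domain of A because A is closed.
   Conversely <A mu(E_n) x, A x> = <S mu(E_n) x, x> = |A mu(E_n) x|^2 gives
   |A mu(E_n) x| <= |A x|, and the integral is finite by monotone convergence.

   Values. Let s_k increase to sqrt(l), v_k = s_k(S) x and u_k = S^{-1/2} v_k.
   Since s_k / sqrt(l) <= 1, v_k is in the domain of A S^{-1/2}, hence
   Q v_k = A u_k. As s_k / sqrt(l) tends to the indicator of ]0, +oo[, u_k tends
   to the projection of x onto N(S)^\perp, and A u_k is Cauchy because
   |A u_j - A u_k| = |v_j - v_k|. So Q v_k tends to A x, again by closedness. *)

Set Implicit Arguments.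
Unset Strict Implicit.
Unset Printing Implicit Defensive.

Import Order.TTheory GRing.Theory Num.Theory.
Import numFieldNormedType.Exports.
Import HBSimple HBNNSimple.

Local Open Scope classical_set_scope.
Local Open Scope ring_scope.
Local Open Scope complex_scope.

(** * Real inner product and convergence in Hilbert spaces *)

Lemma ReD (R : rcfType) (a b : R[i]) :
  complex.Re (a + b) = complex.Re a + complex.Re b.
Proof. by case: a b => [? ?] []. Qed.

Lemma ReN (R : rcfType) (a : R[i]) : complex.Re (- a) = - complex.Re a.
Proof. by case: a. Qed.

Lemma ReZ (R : rcfType) (k : R) (a : R[i]) :
  complex.Re (k%:C * a) = k * complex.Re a.
Proof. by case: a => u v; simpc. Qed.

Lemma Re_conj (R : rcfType) (a : R[i]) :
  complex.Re (Num.conj a) = complex.Re a.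
Proof. by case: a. Qed.

Section hilbert.
Variables (R : realType) (H : hilbertType R).
Implicit Types x y z : H.

Definition rdot x y : R := complex.Re (inner x y).
Definition sqnorm x : R := rdot x x.

Lemma rdotDl x y z : rdot (x + y) z = rdot x z + rdot y z.
Proof. by rewrite /rdot linearDl ReD. Qed.

Lemma rdotNl x z : rdot (- x) z = - rdot x z.
Proof. by rewrite /rdot linearNl ReN. Qed.

Lemma rdotC x y : rdot x y = rdot y x.
Proof. by rewrite /rdot (hermC inner x y) expr0 mul1r Re_conj. Qed.

Lemma rdotBl x y z : rdot (x - y) z = rdot x z - rdot y z.
Proof. by rewrite rdotDl rdotNl. Qed.

Lemma rdotBr x y z : rdot x (y - z) = rdot x y - rdot x z.
Proof. by rewrite rdotC rdotBl !(rdotC x). Qed.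

Lemma rdotZl (a : R) x z : rdot (a%:C *: x) z = a * rdot x z.
Proof.
by rewrite /rdot linearZl_LR ReZ.
Qed.

Lemma rdot0l x : rdot 0 x = 0.
Proof. by rewrite /rdot linear0l. Qed.

Lemma inner_sqnorm x : inner x x = (sqnorm x)%:C.
Proof.
have /complex_realP[k kE] : inner x x \is Num.real.
  by rewrite ger0_real// inner_norm exprn_ge0.
by rewrite /sqnorm /rdot kE.
Qed.

Lemma sqnormE x : `|x| ^+ 2 = (sqnorm x)%:C.
Proof. by rewrite -inner_norm inner_sqnorm. Qed.

Lemma sqnorm_ge0 x : 0 <= sqnorm x.
Proof. by rewrite -lecR -sqnormE exprn_ge0. Qed.

Lemma sqnorm0 : sqnorm 0 = 0.
Proof. exact: rdot0l. Qed.

Lemma sqnorm_eq0 x : sqnorm x = 0 -> x = 0.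
Proof.
move=> x0; have /eqP := sqnormE x.
by rewrite x0 sqrf_eq0 normr_eq0 => /eqP.
Qed.

Lemma sqnormB x y : sqnorm (x - y) = sqnorm x + sqnorm y - 2 * rdot x y.
Proof. by rewrite /sqnorm !(rdotBl, rdotBr) (rdotC y x); lra. Qed.

Lemma sqnormD x y : sqnorm (x + y) = sqnorm x + sqnorm y + 2 * rdot x y.
Proof.
by rewrite /sqnorm rdotDl !(rdotC _ (x + y)) !rdotDl (rdotC y x); lra.
Qed.

Lemma sqnormD_le x y : sqnorm (x + y) <= 2 * sqnorm x + 2 * sqnorm y.
Proof. by have := sqnorm_ge0 (x - y); rewrite sqnormB sqnormD; lra. Qed.

Lemma sqnormBC x y : sqnorm (x - y) = sqnorm (y - x).
Proof. by rewrite !sqnormB (rdotC y x); lra. Qed.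

Lemma norm_lt_sqnorm (e : R) x : 0 < e -> (`|x| < e%:C) = (sqnorm x < e ^+ 2).
Proof.
move=> e0; rewrite -ltcR -sqnormE rmorphXn ltr_pXn2r// nnegrE ?normr_ge0//.
by rewrite ler0c ltW.
Qed.

Lemma cvg_sqnormP (u : nat -> H) x :
  (u k @[k --> \oo] --> x) <->
  forall e : R, 0 < e -> \forall k \near \oo, sqnorm (x - u k) < e.
Proof.
split.
- move=> /cvgrPdist_lt ux e e0.
  have /ux : 0 < (Num.sqrt e)%:C by rewrite ltcR sqrtr_gt0.
  apply: filterS => k; rewrite norm_lt_sqnorm ?sqrtr_gt0// sqr_sqrtr//.
  exact: ltW.
- move=> ux; apply/cvgrPdist_lt => e e0.
  have [a aE] : exists a, e = a%:C.
    by apply/complex_realP; rewrite gtr0_real.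
  have a0 : 0 < a by rewrite -ltcR -aE.
  have /ux : 0 < a ^+ 2 by rewrite exprn_gt0.
  by apply: filterS => k; rewrite aE norm_lt_sqnorm.
Qed.

Lemma cauchy_sqnorm (u : nat -> H) :
  (forall e : R, 0 < e ->
    exists N, forall k l, (N <= k)%N -> (N <= l)%N -> sqnorm (u k - u l) < e) ->
  exists x, u k @[k --> \oo] --> x.
Proof.
move=> uC; suff: cvg (u @ \oo) by move=> ?; exists (lim (u @ \oo)).
apply/cauchy_cvgP/cauchyP => e e0.
have [a aE] : exists a, e = a%:C by apply/complex_realP; rewrite gtr0_real.
have a0 : 0 < a by rewrite -ltcR -aE.
have /uC[N uN] : 0 < a ^+ 2 by rewrite exprn_gt0.
exists (u N), N => // k /= Nk.
by rewrite -ball_normE /= aE norm_lt_sqnorm// uN//=.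
Qed.

Lemma rdot_polar x y : rdot x y = (sqnorm (x + y) - sqnorm (x - y)) / 4.
Proof. by rewrite sqnormD sqnormB; field. Qed.

Lemma cvg_sqnorm (u : nat -> H) x :
  u k @[k --> \oo] --> x -> sqnorm (u k) @[k --> \oo] --> sqnorm x.
Proof.
move=> ux; have nux : `|u k| ^+ 2 @[k --> \oo] --> `|x| ^+ 2.
  by rewrite expr2; under eq_fun do rewrite expr2; apply: cvgM; exact: cvg_norm.
apply/cvgrPdist_lt => e e0.
move/cvgrPdist_lt : nux => /(_ e%:C); rewrite ltcR => /(_ e0).
apply: filterS => k; rewrite !sqnormE -rmorphB normc_def /= expr0n addr0.
by rewrite sqrtr_sqr ltcR.
Qed.

Lemma cvg_rdot (u v : nat -> H) x y :
  u k @[k --> \oo] --> x -> v k @[k --> \oo] --> y ->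
  rdot (u k) (v k) @[k --> \oo] --> rdot x y.
Proof.
move=> ux vy; rewrite rdot_polar; under eq_fun do rewrite rdot_polar.
apply: cvgMl; apply: cvgB; apply: cvg_sqnorm; first exact: cvgD.
exact: cvgB.
Qed.
End hilbert.

(** * Projection-valued measures *)

(* The value 0 on non-measurable sets makes this nonnegative everywhere, as the
   measure structure requires. *)
Definition vector_measure (R : realType) (H : hilbertType R)
    (mu : set (measurableTypeR R) -> H -> H)
    of projection_valued_measure mu := fun (x : H) E =>
  if `[< measurable E >] then (sqnorm (mu E x))%:E else 0%E.

Notation "''m[' pvm ]_ x" := (vector_measure pvm x)
  (at level 8, x at level 2, format "''m[' pvm ]_ x").

Section projection_valued_measure.
Variables (R : realType) (H : hilbertType R).
Variables (mu : set (measurableTypeR R) -> H -> H).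
Hypothesis pvm : projection_valued_measure mu.
Implicit Types (x y : H) (E F : set (measurableTypeR R)).

Lemma pvm_linear E : measurable E -> linear (mu E).
Proof. by case: pvm => /(_ E) + _ _ _ => /[apply]; case. Qed.

Lemma pvmZ E (a : R[i]) x : measurable E -> mu E (a *: x) = a *: mu E x.
Proof.
move=> mE; have linE := pvm_linear mE.
have E0 : mu E 0 = 0.
  by have := linE (-1) 0 0; rewrite scaler0 addr0 scaleN1r addNr.
by rewrite -[a *: x]addr0 linE E0 addr0.
Qed.

Lemma pvmD E x y : measurable E -> mu E (x + y) = mu E x + mu E y.
Proof.
by move=> mE; rewrite -[x in LHS]scale1r (pvm_linear mE) scale1r.
Qed.

Lemma pvm_vec0 E : measurable E -> mu E 0 = 0.
Proof. by move=> mE; rewrite -[X in mu E X](scale0r 0) pvmZ// scale0r. Qed.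

Lemma pvmB E x y : measurable E -> mu E (x - y) = mu E x - mu E y.
Proof. by move=> mE; rewrite pvmD// -scaleN1r pvmZ// scaleN1r. Qed.

Lemma pvm_sum E (I : Type) (s : seq I) (f : I -> H) : measurable E ->
  mu E (\sum_(i <- s) f i) = \sum_(i <- s) mu E (f i).
Proof.
move=> mE; apply: big_morph => [u v|]; first exact: pvmD.
exact: pvm_vec0.
Qed.

Lemma pvm_set0 x : mu set0 x = 0.
Proof. by case: pvm => _ [-> _]. Qed.

Lemma pvm_setT x : mu setT x = x.
Proof. by case: pvm => _ [_ ->]. Qed.

Lemma pvmI E F x : measurable E -> measurable F ->
  mu (E `&` F) x = mu E (mu F x).
Proof. by move=> mE mF; case: pvm => _ _ -> // _. Qed.

Lemma pvmC E F x : measurable E -> measurable F ->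
  mu E (mu F x) = mu F (mu E x).
Proof. by move=> mE mF; rewrite -!pvmI// setIC. Qed.

Lemma pvm_idem E x : measurable E -> mu E (mu E x) = mu E x.
Proof. by move=> mE; rewrite -pvmI// setIid. Qed.

Lemma inner_pvm E x y : measurable E -> inner (mu E x) y = inner x (mu E y).
Proof. by move=> mE; case: pvm => /(_ E mE)[_ _ ->]. Qed.

Lemma rdot_pvm E x y : measurable E -> rdot (mu E x) y = rdot x (mu E y).
Proof.
by move=> mE; rewrite /rdot inner_pvm.
Qed.

Lemma rdot_pvm_self E x : measurable E -> rdot (mu E x) x = sqnorm (mu E x).
Proof. by move=> mE; rewrite -[in LHS]pvm_idem// rdot_pvm. Qed.

Lemma pvm_setU E F x : measurable E -> measurable F -> E `&` F = set0 ->
  mu (E `|` F) x = mu E x + mu F x.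
Proof.
move=> mE mF EF0; case: pvm => _ _ _ /(_ (bigcup2 E F) x).
rewrite bigcup2E => cvgEF.
have /cvgEF : forall n, measurable (bigcup2 E F n).
  by move=> [|[|n]]//=; exact: measurable0.
rewrite -trivIset_bigcup2 => /(_ EF0) EFx.
apply: (cvg_unique (@norm_hausdorff _ H) EFx).
apply: cvg_near_cst; exists 2%N => // -[|[|n]]//= _.
rewrite !big_nat_recl//= big1 ?addr0// => i _; exact: pvm_set0.
Qed.

Lemma pvm_setC E x : measurable E -> mu (~` E) x = x - mu E x.
Proof.
move=> mE; have := pvm_setU x mE (measurableC mE) (setICr E).
by rewrite setUv pvm_setT => /esym/(canRL (addKr _)) ->; rewrite addrC.
Qed.

Lemma vector_measureE x E : measurable E -> 'm[pvm]_x E = (sqnorm (mu E x))%:E.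
Proof. by move=> mE; rewrite /vector_measure asboolT. Qed.

Lemma scalar_measureE x E : measurable E -> scalar_measure mu x E = 'm[pvm]_x E.
Proof. by move=> mE; rewrite vector_measureE// -rdot_pvm_self. Qed.

Section vector_measure.
Variable x : H.

Let measure0 : 'm[pvm]_x set0 = 0%E.
Proof. by rewrite vector_measureE// pvm_set0 sqnorm0. Qed.

Let measure_ge0 E : (0 <= 'm[pvm]_x E)%E.
Proof.
by rewrite /vector_measure; case: asboolP => // _; rewrite lee_fin sqnorm_ge0.
Qed.

Let measure_semi_sigma_additive : semi_sigma_additive 'm[pvm]_x.
Proof.
move=> F mF tF mUF; rewrite vector_measureE// -rdot_pvm_self//.
under eq_fun => n.
  under eq_bigr do rewrite vector_measureE// -rdot_pvm_self//.
  over.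
have -> : (fun n => (\sum_(0 <= i < n) (rdot (mu (F i) x) x)%:E)%E) =
    EFin \o (fun n => rdot (\sum_(0 <= i < n) mu (F i) x) x).
  apply/funext => n /=; rewrite sumEFin; congr EFin.
  by rewrite (big_morph (fun u => rdot u x)
    (fun u v => rdotDl u v x) (rdot0l x)).
apply: cvg_EFin; first exact: nearW.
by apply: cvg_rdot; [case: pvm => _ _ _; exact|exact: cvg_cst].
Qed.

HB.instance Definition _ := isMeasure.Build _ _ _ 'm[pvm]_x
  measure0 measure_ge0 measure_semi_sigma_additive.

Let fin_num_measure : fin_num_fun 'm[pvm]_x.
Proof. by move=> E mE; rewrite vector_measureE. Qed.

HB.instance Definition _ := Measure_isFinite.Build _ _ _ 'm[pvm]_x
  fin_num_measure.

End vector_measure.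

Lemma square_integrableE f x :
  square_integrable mu f x = (\int['m[pvm]_x]_l (f l ^+ 2)%:E < +oo)%E.
Proof.
have sE (h : {nnsfun measurableTypeR R >-> R}) :
    sintegral (scalar_measure mu x) h = sintegral 'm[pvm]_x h.
  by apply: eq_fsbigr => r _; rewrite scalar_measureE.
rewrite /square_integrable /mkset /integral.
under eq_imagel do rewrite sE.
by under [in X in (_ - X)%E]eq_imagel do rewrite sE.
Qed.

End projection_valued_measure.

Section simple_integral.
Variables (R : realType) (H : hilbertType R).
Variables (mu : set (measurableTypeR R) -> H -> H).
Hypothesis pvm : projection_valued_measure mu.
Implicit Types (x y : H) (E F : set (measurableTypeR R)).
Implicit Types (s t : {sfun measurableTypeR R >-> R}).

Section fibers.
Variables (I : choiceType) (p : measurableTypeR R -> I).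
Hypothesis finp : finite_set (range p).
Hypothesis mp : forall i, measurable (p @^-1` [set i]).

Let mfiber E i : measurable E -> measurable (E `&` p @^-1` [set i]).
Proof. by move=> mE; exact: measurableI. Qed.

Lemma pvm_fibers E x : measurable E ->
  mu E x = \sum_(i \in range p) mu (E `&` p @^-1` [set i]) x.
Proof.
move=> mE; rewrite fsbig_finite//=.
have -> : mu E x = mu (E `&` p @^-1` [set` enum_fset (fset_set (range p))]) x.
  rewrite (_ : p @^-1` _ = setT) ?setIT// -subTset => l _ /=.
  have : p l \in fset_set (range p).
    by rewrite in_fset_set// mem_set//; exists l.
  by [].
have := fset_uniq (fset_set (range p)).
elim: (enum_fset _) => [_|i s IHs] /=.
  rewrite big_nil (_ : _ `&` _ = set0) ?(pvm_set0 pvm)//.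
  by rewrite -subset0 => l [_].
move=> /andP[si us]; rewrite big_cons -IHs//.
rewrite (_ : p @^-1` _ = p @^-1` [set i] `|` p @^-1` [set` s]); last first.
  apply/seteqP; split=> l /=; first by rewrite inE => /orP[/eqP|]; [left|right].
  by case=> [<-|ls]; rewrite inE ?eqxx// ls orbT.
rewrite setIUr (pvm_setU pvm)//; first exact: mfiber.
  apply: measurableI => //.
  rewrite (_ : p @^-1` _ = \big[setU/set0]_(j <- s) p @^-1` [set j]).
    by apply: bigsetU_measurable.
  rewrite -bigcup_seq; apply/seteqP; split=> [l ls|l [j js /= ->]//].
  by exists (p l).
rewrite setIACA setIid -subset0 => l [_ [/= pli pls]].
by move: si; rewrite -pli pls.
Qed.

Definition fiber_sum (g : I -> R) x : H :=
  \sum_(i \in range p) (g i)%:C *: mu (p @^-1` [set i]) x.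

Lemma simple_integral_fiber_sum s (g : I -> R) x :
  (forall l, s l = g (p l)) -> simple_integral mu s x = fiber_sum g x.
Proof.
move=> sg; rewrite /simple_integral /fiber_sum !fsbig_finite//=.
under eq_bigr => a _.
  rewrite (@pvm_fibers (s @^-1` [set a]))// fsbig_finite// scaler_sumr.
  over.
rewrite exchange_big /=; rewrite big_seq [RHS]big_seq; apply: eq_bigr => i.
rewrite in_fset_set// => /set_mem[l _ <-].
rewrite (bigD1_seq (g (p l))) ?fset_uniq//=; last first.
  by rewrite in_fset_set// mem_set//; exists l => //; rewrite sg.
rewrite big1 ?addr0.
  congr (_ *: mu _ _); apply/seteqP; split=> [k []//|k /= kl]; split => //.
  by rewrite sg kl.
move=> a ag; rewrite (_ : _ `&` _ = set0) ?(pvm_set0 pvm) ?scaler0// -subset0.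
by move=> k [/= ka kl]; move: ag; rewrite -ka sg kl eqxx.
Qed.

Lemma fiber_sumB (f g : I -> R) x :
  fiber_sum f x - fiber_sum g x = fiber_sum (fun i => f i - g i) x.
Proof.
rewrite /fiber_sum !fsbig_finite//= -sumrB; apply: eq_bigr => i _.
by rewrite -scalerBl rmorphB.
Qed.

Lemma pvm_fiber_sum (g : I -> R) E x : measurable E ->
  mu E (fiber_sum g x) = fiber_sum g (mu E x).
Proof.
move=> mE; rewrite /fiber_sum !fsbig_finite//= pvm_sum//; apply: eq_bigr => i _.
by rewrite pvmZ// pvmC.
Qed.

Lemma fiber_sumM (f g : I -> R) x :
  fiber_sum f (fiber_sum g x) = fiber_sum (fun i => f i * g i) x.
Proof.
rewrite {1 3}/fiber_sum; apply: eq_fsbigr => i _; rewrite pvm_fiber_sum//.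
rewrite rmorphM -scalerA; congr (_ *: _).
have [[l _ li]|pi] := pselect (range p i); last first.
  rewrite (_ : p @^-1` _ = set0); last first.
    by rewrite -subset0 => l /= li; apply: pi; exists l.
  rewrite (pvm_set0 pvm) scaler0 /fiber_sum fsbig_finite//= big1// => j _.
  by rewrite pvm_vec0// scaler0.
rewrite /fiber_sum fsbig_finite//= (bigD1_seq i) ?fset_uniq//=; last first.
  by rewrite in_fset_set// mem_set//; exists l.
rewrite (pvm_idem pvm)// big1 ?addr0// => j ji.
rewrite -(pvmI pvm)// (_ : _ `&` _ = set0) ?(pvm_set0 pvm) ?scaler0// -subset0.
by move=> k [/= kj ki]; move: ji; rewrite -kj ki eqxx.
Qed.

Lemma rdot_fiber_sum (g : I -> R) x y :
  rdot (fiber_sum g x) y = rdot x (fiber_sum g y).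
Proof.
have rdotE z w : rdot (fiber_sum g z) w =
    \sum_(i <- fset_set (range p)) g i * rdot (mu (p @^-1` [set i]) z) w.
  rewrite /fiber_sum fsbig_finite//=.
  rewrite (big_morph (fun u => rdot u w) (fun u v => rdotDl u v w) (rdot0l w)).
  by apply: eq_bigr => i _; rewrite rdotZl.
rewrite [RHS]rdotC !rdotE; apply: eq_bigr => i _.
by rewrite rdot_pvm// rdotC.
Qed.

End fibers.

Local Notation si := (simple_integral mu).

Let pair_fibers s t (p := fun l => (s l, t l)) :
  finite_set (range p) /\ forall i, measurable (p @^-1` [set i]).
Proof.
split=> [|[a b]].
  apply: (@sub_finite_set _ _ (range s `*` range t)); last exact: finite_setX.
  by move=> _ [l _ <-]; split; exists l.
rewrite (_ : p @^-1` _ = s @^-1` [set a] `&` t @^-1` [set b]).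
  exact: measurableI.
by apply/seteqP; split=> l /=; [case=> -> ->|case=> <- <-].
Qed.

Lemma simple_integralB s t x : si (s - t) x = si s x - si t x.
Proof.
have [finp mp] := pair_fibers s t.
rewrite (simple_integral_fiber_sum finp mp (g := fun ab => ab.1 - ab.2))//.
rewrite (simple_integral_fiber_sum finp mp (s := s) (g := fst))//.
rewrite (simple_integral_fiber_sum finp mp (s := t) (g := snd))//.
by rewrite fiber_sumB.
Qed.

Lemma simple_integralM s t x : si (s * t) x = si s (si t x).
Proof.
have [finp mp] := pair_fibers s t.
rewrite (simple_integral_fiber_sum finp mp (g := fun ab => ab.1 * ab.2))//.
rewrite !(simple_integral_fiber_sum finp mp (s := s) (g := fst))//.
rewrite (simple_integral_fiber_sum finp mp (s := t) (g := snd))//.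
by rewrite fiber_sumM.
Qed.

Lemma rdot_simple_integral s x y : rdot (si s x) y = rdot x (si s y).
Proof. by apply: rdot_fiber_sum. Qed.

Lemma simple_integral_indic E x (mE : measurable E) :
  si (indic_sfun E mE) x = mu E x.
Proof.
rewrite (pvm_fibers (p := indic_sfun E mE : measurableTypeR R -> R) _ _ x mE)//.
apply: eq_fsbigr => _ /set_mem[l _ <-].
have sE k : indic_sfun E mE k = (k \in E)%:R :> R by exact: indicE.
rewrite sE; have [lE|lE] := boolP (l \in E).
  rewrite scale1r setIidr// => k /=; rewrite sE => /eqP.
  by rewrite pnatr_eq1 eqb1 => /set_mem.
rewrite scale0r (_ : _ `&` _ = set0) ?(pvm_set0 pvm)// -subset0 => k [kE] /=.
by rewrite sE mem_set// => /eqP; rewrite oner_eq0.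
Qed.

Lemma integral_vector_measure s x :
  (\int['m[pvm]_x]_l (s l)%:E = (rdot (si s x) x)%:E)%E.
Proof.
under eq_integral do rewrite fimfunE fsbig_finite//= -sumEFin.
have ind a : measurable (s @^-1` [set a]) by [].
rewrite integral_sum//; last first.
  move=> a; under eq_fun do rewrite EFinM.
  by apply: integrableZl => //; exact: integrable_indic.
rewrite /simple_integral fsbig_finite//=.
rewrite (big_morph (fun u => rdot u x) (fun u v => rdotDl u v x) (rdot0l x)).
rewrite -sumEFin; apply: eq_bigr => a _.
under eq_integral do rewrite EFinM.
rewrite integralZl//; last exact: integrable_indic.
by rewrite integral_indic// setIT /= vector_measureE// -rdot_pvm_self// rdotZl.
Qed.

Lemma integral_vector_measure_sqr s x :
  (\int['m[pvm]_x]_l (s l ^+ 2)%:E = (sqnorm (si s x))%:E)%E.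
Proof.
rewrite /sqnorm -rdot_simple_integral -simple_integralM.
by rewrite -integral_vector_measure.
Qed.

End simple_integral.

(** * Approximation in mean square *)

Section square_dominated_convergence.
Context d (T : measurableType d) (R : realType).
Variable m : {measure set T -> \bar R}.
Implicit Types f g h : T -> R.

Lemma measurable_sqrB f g : measurable_fun setT f -> measurable_fun setT g ->
  measurable_fun setT (fun l => ((f l - g l) ^+ 2)%:E).
Proof.
move=> mf mg; apply/measurable_EFinP.
by apply: measurable_funX; exact: measurable_funB.
Qed.

Lemma integral_sqrB_le f g h : measurable_fun setT f ->
  measurable_fun setT g -> measurable_fun setT h ->
  (\int[m]_l ((g l - h l) ^+ 2)%:E <= 2%:E * \int[m]_l ((g l - f l) ^+ 2)%:E +
    2%:E * \int[m]_l ((h l - f l) ^+ 2)%:E)%E.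
Proof.
move=> mf mg mh.
rewrite -!ge0_integralZl//; try (by move=> l _; rewrite lee_fin sqr_ge0);
  try exact: measurable_sqrB.
have mZ (w : T -> R) : measurable_fun setT w ->
    measurable_fun setT (fun l => 2%:E * ((w l - f l) ^+ 2)%:E)%E.
  by move=> mw; apply: measurable_funeM; exact: measurable_sqrB.
have Z0 (w : T -> R) l : setT l -> (0 <= 2%:E * ((w l - f l) ^+ 2)%:E)%E.
  by rewrite -EFinM lee_fin mulr_ge0// sqr_ge0.
rewrite -ge0_integralD//; try exact: mZ; try exact: Z0.
apply: ge0_le_integral => //.
- by move=> l _; rewrite lee_fin sqr_ge0.
- exact: measurable_sqrB.
- by apply: emeasurable_funD; exact: mZ.
- move=> l _; rewrite -!EFinM -EFinD lee_fin.
  have := sqr_ge0 (g l - f l + (h l - f l)); nra.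
Qed.

Variables (f : T -> R) (mf : measurable_fun setT f).
Hypothesis f2 : (\int[m]_l (f l ^+ 2)%:E < +oo)%E.

Lemma square_dominated_cvg (u : nat -> T -> R) :
  (forall k, measurable_fun setT (u k)) ->
  (forall k l, `|u k l| <= `|f l|) ->
  (forall l, u k l @[k --> \oo] --> f l) ->
  (\int[m]_l ((u k l - f l) ^+ 2)%:E @[k --> \oo] --> 0)%E.
Proof.
move=> mu uf ucvg.
have mf2 : measurable_fun setT (fun l => (f l ^+ 2)%:E).
  by apply/measurable_EFinP; exact: measurable_funX.
have := @dominated_convergence _ _ _ m setT measurableT
  (fun k l => ((u k l - f l) ^+ 2)%:E) (cst 0%E)
  (fun l => 4%:E * (f l ^+ 2)%:E)%E.
case.
- by move=> k; exact: measurable_sqrB.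
- exact: measurable_cst.
- apply: nearW => l _; apply: cvg_EFin; first exact: nearW.
  have d0 : u k l - f l @[k --> \oo] --> 0.
    by rewrite -(subrr (f l)); apply: cvgB; [exact: ucvg|exact: cvg_cst].
  have /(_ _) := cvgM d0 d0; rewrite mulr0; exact.
- apply: integrableZl => //; apply/integrableP; split=> //.
  by under eq_integral do rewrite gee0_abs ?lee_fin ?sqr_ge0//.
- apply: nearW => l k _; rewrite -EFinM lee_fin ger0_norm ?sqr_ge0//.
  have ufl : `|u k l - f l| <= 2 * `|f l|.
    rewrite (le_trans (ler_normB _ _))//; have := uf k l; lra.
  rewrite -[leLHS]real_normK ?num_real// -[f l ^+ 2]real_normK ?num_real//.
  by have := normr_ge0 (u k l - f l); nra.
- by move=> _ _; rewrite integral0.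
Qed.

Lemma square_dominated_cauchy (u v : nat -> T -> R) :
  (forall k, measurable_fun setT (u k)) ->
  (forall k, measurable_fun setT (v k)) ->
  (forall k l, `|u k l| <= `|f l|) -> (forall k l, `|v k l| <= `|f l|) ->
  (forall l, u k l @[k --> \oo] --> f l) ->
  (forall l, v k l @[k --> \oo] --> f l) ->
  forall e : R, 0 < e -> exists N, forall j k, (N <= j)%N -> (N <= k)%N ->
    (\int[m]_l ((u j l - v k l) ^+ 2)%:E < e%:E)%E.
Proof.
move=> mu mv uf vf ucvg vcvg e e0.
have e4 : (0 < (e / 4)%:E)%E by rewrite lte_fin divr_gt0.
have small (w : nat -> T -> R) : (forall k, measurable_fun setT (w k)) ->
    (forall k l, `|w k l| <= `|f l|) ->
    (forall l, w k l @[k --> \oo] --> f l) ->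
    exists N, forall k, (N <= k)%N ->
      (\int[m]_l ((w k l - f l) ^+ 2)%:E < (e / 4)%:E)%E.
  move=> mw wf wcvg; have := square_dominated_cvg mw wf wcvg.
  move=> /(_ [set r | (r < (e / 4)%:E)%E]) [|N _ wN].
    by apply: (open_nbhs_nbhs _); split => //; exact: open_ereal_lt_ereal.
  by exists N => k Nk; exact: wN.
have [N1 uN] := small _ mu uf ucvg; have [N2 vN] := small _ mv vf vcvg.
exists (maxn N1 N2) => j k; rewrite !geq_max => /andP[N1j _] /andP[_ N2k].
apply: (@le_lt_trans _ _ (2%:E * \int[m]_l ((u j l - f l) ^+ 2)%:E +
    2%:E * \int[m]_l ((v k l - f l) ^+ 2)%:E)%E).
  by apply: integral_sqrB_le.
have -> : e%:E = (2%:E * (e / 4)%:E + 2%:E * (e / 4)%:E)%E.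
  by rewrite -!EFinM -EFinD; congr EFin; field.
by apply: lteD; rewrite lte_pmul2l// ?uN// vN.
Qed.

End square_dominated_convergence.

Section simple_approximation.
Context d (T : measurableType d) (R : realType).
Implicit Types f : T -> R.

Lemma nnsfun_approximation f : measurable_fun setT f -> (forall l, 0 <= f l) ->
  exists h : nat -> {nnsfun T >-> R},
    (forall l, nondecreasing_seq (fun k => h k l)) /\
    (forall l, h k l @[k --> \oo] --> f l).
Proof.
move=> mf f0.
have mEf : measurable_fun setT (EFin \o f) by exact/measurable_EFinP.
exists (nnsfun_approx measurableT mEf); split=> l.
  by move=> j k jk; exact/lefP/nd_nnsfun_approx.
have := @cvg_nnsfun_approx _ _ _ _ measurableT _ mEf _ l Logic.I.
by move=> /(_ _)/fine_cvgP[|//] => t _; rewrite lee_fin.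
Qed.

Lemma nondecreasing_cvg_ge0_le (u : nat -> R) r : nondecreasing_seq u ->
  u k @[k --> \oo] --> r -> forall k, u k <= r.
Proof.
move=> nu ur k; rewrite -(cvg_lim _ ur)//.
by apply: nondecreasing_cvgn_le => //; apply/cvg_ex; exists r.
Qed.

Lemma sfun_approximation f : measurable_fun setT f ->
  exists s : nat -> {sfun T >-> R},
    (forall k l, `|s k l| <= `|f l|) /\
    (forall l, s k l @[k --> \oo] --> f l).
Proof.
move=> mf.
have [p [ndp pf]] :=
  nnsfun_approximation (measurable_funrpos mf) (funrpos_ge0 f).
have [n [ndn nf]] :=
  nnsfun_approximation (measurable_funrneg mf) (funrneg_ge0 f).
exists (fun k => (p k : {sfun T >-> R}) - (n k : {sfun T >-> R})).
split=> [k l|l]; last first.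
  suff : p k l - n k l @[k --> \oo] --> f l by [].
  by rewrite -[f in f l]funrposBneg; apply: cvgB; [exact: pf|exact: nf].
suff : `|p k l - n k l| <= `|f l| by [].
have pfl := nondecreasing_cvg_ge0_le (ndp l) (pf l) k.
have nfl := nondecreasing_cvg_ge0_le (ndn l) (nf l) k.
have p0 : 0 <= p k l by exact: fun_ge0.
have n0 : 0 <= n k l by exact: fun_ge0.
have <- : f^\+ l + f^\- l = `|f l|.
  by rewrite -[RHS]/((Num.norm \o f) l) -funrposDneg.
by rewrite ler_norml; apply/andP; split; lra.
Qed.

End simple_approximation.

(** * Spectral integrals *)

Lemma indic_sqr (R : realType) (E : set (measurableTypeR R)) l :
  (\1_E l : R) ^+ 2 = \1_E l.
Proof. by rewrite indicE; case: (l \in E); rewrite ?expr1n ?expr0n. Qed.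

Section spectral_integral.
Variables (R : realType) (H : hilbertType R).
Variables (mu : set (measurableTypeR R) -> H -> H).
Hypothesis pvm : projection_valued_measure mu.
Implicit Types (x y : H) (E F : set (measurableTypeR R)).
Implicit Types (s t : {sfun measurableTypeR R >-> R}).
Implicit Types f : measurableTypeR R -> R.

Local Notation si := (simple_integral mu).

Lemma measurable_sfun s : measurable_fun setT s.
Proof. by []. Qed.

Lemma sqnorm_pvm_le E x : measurable E -> sqnorm (mu E x) <= sqnorm x.
Proof.
move=> mE; have := sqnorm_ge0 (x - mu E x).
rewrite sqnormB (rdotC x) rdot_pvm_self//; lra.
Qed.

Lemma pvm_cvg E (u : nat -> H) x : measurable E ->
  u k @[k --> \oo] --> x -> mu E (u k) @[k --> \oo] --> mu E x.
Proof.
move=> mE /cvg_sqnormP ux; apply/cvg_sqnormP => e /ux; apply: filterS => k.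
by apply: le_lt_trans; rewrite -(pvmB pvm)// sqnorm_pvm_le.
Qed.

Lemma sqnorm_simple_integralB s t x :
  ((sqnorm (si s x - si t x))%:E = \int['m[pvm]_x]_l ((s l - t l) ^+ 2)%:E)%E.
Proof. by rewrite -simple_integralB// -(integral_vector_measure_sqr pvm). Qed.

Lemma simple_integral_eq0 s x : (forall l, s l = 0) -> si s x = 0.
Proof.
move=> s0; apply/sqnorm_eq0/EFin_inj.
rewrite -(integral_vector_measure_sqr pvm).
by under eq_integral do rewrite s0 expr0n/=; rewrite integral0.
Qed.

Section spectral_integral_cvg.
Variables (f : measurableTypeR R -> R) (x : H).
Hypothesis mf : measurable_fun setT f.
Hypothesis xf : square_integrable mu f x.

Let intf : (\int['m[pvm]_x]_l (f l ^+ 2)%:E < +oo)%E.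
Proof. by rewrite -square_integrableE. Qed.

Let simple_cauchy (s t : nat -> {sfun measurableTypeR R >-> R}) :
  (forall k l, `|s k l| <= `|f l|) -> (forall k l, `|t k l| <= `|f l|) ->
  (forall l, s k l @[k --> \oo] --> f l) ->
  (forall l, t k l @[k --> \oo] --> f l) ->
  forall e : R, 0 < e -> exists N, forall j k, (N <= j)%N -> (N <= k)%N ->
    sqnorm (si (s j) x - si (t k) x) < e.
Proof.
move=> sf tf scvg tcvg e e0.
have [N stN] := square_dominated_cauchy mf intf
  (fun k => measurable_sfun (s k)) (fun k => measurable_sfun (t k))
  sf tf scvg tcvg e0.
by exists N => j k Nj Nk; rewrite -lte_fin sqnorm_simple_integralB stN.
Qed.

Lemma spectral_integral_cvg (s : nat -> {sfun measurableTypeR R >-> R}) :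
  (forall k l, `|s k l| <= `|f l|) ->
  (forall l, s k l @[k --> \oo] --> f l) ->
  si (s k) x @[k --> \oo] --> spectral_integral mu f x.
Proof.
rewrite /spectral_integral /=; case: xgetP => [z _ +|noz]; first exact.
have [t [tf tcvg]] := sfun_approximation mf.
have [z tz] := cauchy_sqnorm (simple_cauchy tf tf tcvg tcvg).
exfalso; apply: (noz z) => {}s sf scvg.
apply/cvg_sqnormP => e e0; have e4 : 0 < e / 4 by rewrite divr_gt0.
have [N stN] := simple_cauchy tf sf tcvg scvg e4.
move/cvg_sqnormP : tz => /(_ _ e4)[M _ tM].
exists N => // k /= Nk; pose j := maxn N M.
rewrite -(subrKA (si (t j) x)).
apply: (le_lt_trans (sqnormD_le _ _)).
have := tM j (leq_maxr _ _); have := stN j k (leq_maxl _ _) Nk; rewrite /=; lra.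
Qed.

Lemma sqnorm_spectral_integral :
  ((sqnorm (spectral_integral mu f x))%:E = \int['m[pvm]_x]_l (f l ^+ 2)%:E)%E.
Proof.
have [s [sf scvg]] := sfun_approximation mf.
have := spectral_integral_cvg sf scvg => /cvg_sqnorm six.
have {}six : ((sqnorm (si (s k) x))%:E @[k --> \oo] -->
    (sqnorm (spectral_integral mu f x))%:E)%E.
  by apply: cvg_EFin; [exact: nearW|].
apply: (cvg_unique (@ereal_hausdorff R) six).
have -> : (fun k => (sqnorm (si (s k) x))%:E) =
    (fun k => \int['m[pvm]_x]_l (s k l ^+ 2)%:E)%E.
  by apply/funext => k; rewrite (integral_vector_measure_sqr pvm).
have mf2 : measurable_fun setT (fun l => (f l ^+ 2)%:E).
  by apply/measurable_EFinP; exact: measurable_funX.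
have [] // := @dominated_convergence _ _ _ 'm[pvm]_x setT measurableT
  (fun k l => (s k l ^+ 2)%:E) (fun l => (f l ^+ 2)%:E)
  (fun l => (f l ^+ 2)%:E).
- by move=> k; apply/measurable_EFinP; exact: measurable_funX.
- apply: nearW => l _; apply: cvg_EFin; first exact: nearW.
  have /(_ _) := cvgM (scvg l) (scvg l); exact.
- apply/integrableP; split=> //.
  by under eq_integral do rewrite gee0_abs ?lee_fin ?sqr_ge0//.
- apply: nearW => l k _; rewrite lee_fin ger0_norm ?sqr_ge0//.
  rewrite -[leLHS]real_normK ?num_real// -[leRHS]real_normK ?num_real//.
  by rewrite lerXn2r ?nnegrE.
Qed.

End spectral_integral_cvg.

Lemma integral_simple_integral (f : measurableTypeR R -> R) s x :
  measurable_fun setT f -> (forall l, 0 <= f l) ->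
  (\int['m[pvm]_(si s x)]_l (f l)%:E = \int['m[pvm]_x]_l (f l * s l ^+ 2)%:E)%E.
Proof.
move=> mf f0; have [h [ndh hf]] := nnsfun_approximation mf f0.
have E1 : (\int['m[pvm]_(si s x)]_l (h k l)%:E @[k --> \oo] -->
    \int['m[pvm]_(si s x)]_l (f l)%:E)%E.
  have /= := @cvg_monotone_convergence _ _ _ 'm[pvm]_(si s x) setT measurableT
    (fun k l => (h k l)%:E).
  under [X in _ -> _ -> _ -> _ --> X]eq_integral => l _.
    rewrite (_ : limn _ = (f l)%:E); last first.
      by apply/cvg_lim => //; apply: cvg_EFin; [exact: nearW|exact: hf].
    over.
  apply=> //.
  - by move=> k; exact/measurable_EFinP.
  - by move=> k l _; rewrite lee_fin.
  - by move=> l _ j k jk; rewrite lee_fin ndh.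
have E2 : (\int['m[pvm]_x]_l (h k l * s l ^+ 2)%:E @[k --> \oo] -->
    \int['m[pvm]_x]_l (f l * s l ^+ 2)%:E)%E.
  have /= := @cvg_monotone_convergence _ _ _ 'm[pvm]_x setT measurableT
    (fun k l => (h k l * s l ^+ 2)%:E).
  under [X in _ -> _ -> _ -> _ --> X]eq_integral => l _.
    rewrite (_ : limn _ = (f l * s l ^+ 2)%:E); last first.
      apply/cvg_lim => //; apply: cvg_EFin; first exact: nearW.
      by apply: cvgMl; exact: hf.
    over.
  apply=> //.
  - move=> k; apply/measurable_EFinP; apply: measurable_funM => //.
    exact: measurable_funX.
  - by move=> k l _; rewrite lee_fin mulr_ge0// sqr_ge0.
  - by move=> l _ j k jk; rewrite lee_fin ler_wpM2r ?sqr_ge0// ndh.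
apply: (cvg_unique (@ereal_hausdorff R) E1).
have -> : (fun k => \int['m[pvm]_(si s x)]_l (h k l)%:E)%E =
    (fun k => \int['m[pvm]_x]_l (h k l * s l ^+ 2)%:E)%E; last exact: E2.
apply/funext => k; rewrite (integral_vector_measure pvm (h k)).
rewrite -rdot_simple_integral// -!simple_integralM// -integral_vector_measure.
apply: eq_integral => l _; congr EFin.
suff : s l * h k l * s l = h k l * s l ^+ 2 by []; ring.
Qed.

Lemma pvm_cvg_set E (F : nat -> set (measurableTypeR R)) x :
  measurable E -> (forall k, measurable (F k)) -> (forall k, F k `<=` E) ->
  (forall l, E l -> \forall k \near \oo, F k l) ->
  mu (F k) x @[k --> \oo] --> mu E x.
Proof.
move=> mE mF FE Ecvg; apply/cvg_sqnormP => e e0.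
have mi (G : set (measurableTypeR R)) : measurable G ->
    measurable_fun setT (\1_G : measurableTypeR R -> R) by [].
have E2 : (\int['m[pvm]_x]_l (\1_E l ^+ 2)%:E < +oo)%E.
  under eq_integral do rewrite indic_sqr; rewrite integral_indic// setIT /=.
  by rewrite vector_measureE// ltry.
have le1 (G : set (measurableTypeR R)) l : G `<=` E ->
    `|\1_G l| <= `|\1_E l| :> R.
  move=> GE; rewrite !indicE !ger0_norm ?ler0n// ler_nat.
  by have [/set_mem/GE/mem_set ->|] := boolP (l \in G).
have Fcvg (l : measurableTypeR R) :
    (\1_(F k) l : R) @[k --> \oo] --> (\1_E l : R).
  have [lE|lE] := boolP (l \in E).
    apply: cvg_near_cst; have /set_mem/Ecvg := lE; apply: filterS => k Fkl.
    by rewrite !indicE lE mem_set.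
  apply: cvg_near_cst; apply: nearW => k; rewrite !indicE (negbTE lE).
  by rewrite memNset// => /FE /mem_set; apply/negP.
have [N FN] := square_dominated_cauchy (mi E mE) E2 (fun=> mi E mE)
  (fun k => mi (F k) (mF k)) (fun k l => le1 E l (fun _ => id))
  (fun k l => le1 (F k) l (FE k)) (fun l => cvg_cst _) Fcvg e0.
exists N => // k /= Nk.
rewrite -(simple_integral_indic pvm _ mE) -(simple_integral_indic pvm _ (mF k)).
by rewrite -lte_fin sqnorm_simple_integralB (FN N k).
Qed.

End spectral_integral.

Section sqrt_functions.
Variable R : realType.

Lemma sqrt_nnegE (l : R) : sqrt_nneg l = Num.sqrt l.
Proof.
rewrite /sqrt_nneg indicE; have [l0|l0] := leP 0 l.
  by rewrite mem_set ?mulr1//= in_itv/= l0.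
by rewrite ltr0_sqrtr// mul0r.
Qed.

Lemma sqrt_nneg_sqr (l : R) :
  sqrt_nneg l ^+ 2 = l * \1_(`[0, +oo[ : set (measurableTypeR R)) l.
Proof.
rewrite sqrt_nnegE indicE; have [l0|l0] := leP 0 l.
  by rewrite sqr_sqrtr// mem_set ?mulr1//= in_itv/= l0.
rewrite ltr0_sqrtr// memNset ?mulr0 ?expr0n//= in_itv/= andbT.
by apply/negP; rewrite -ltNge.
Qed.

Lemma inv_sqrtE (l : R) : inv_sqrt l = (Num.sqrt l)^-1.
Proof.
rewrite /inv_sqrt indicE; have [l0|l0] := ltP 0 l.
  by rewrite mem_set ?mulr1//= in_itv/= l0.
by rewrite ler0_sqrtr// invr0 mul0r.
Qed.

Lemma measurable_sqrt_nneg :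
  measurable_fun setT (@sqrt_nneg R : measurableTypeR R -> R).
Proof.
rewrite (_ : @sqrt_nneg R = Num.sqrt); last first.
  by apply/funext => l; exact: sqrt_nnegE.
by apply: continuous_measurable_fun; exact: sqrt_continuous.
Qed.

Lemma measurable_inv_sqrt :
  measurable_fun setT (@inv_sqrt R : measurableTypeR R -> R).
Proof.
have -> : @inv_sqrt R = fun l => l `^ (- 2^-1) * \1_(`]0, +oo[) l.
  apply/funext => l; rewrite /inv_sqrt.
  have [l0|l0] := ltP 0 l; first by rewrite powRN powR12_sqrt// ltW.
  rewrite indicE memNset ?mulr0//= in_itv/= andbT.
  by apply/negP; rewrite -leNgt.
apply: measurable_funM; first exact: measurable_powR.
exact: measurable_indic.
Qed.

End sqrt_functions.

(** * The spectral measure of A^* A *)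

Section linear_operator.
Variables (R : realType) (H K : hilbertType R) (A : operator H K).
Hypothesis linA : linear_op A.
Implicit Types x y z : H.

Lemma linear_opB x y : domain A x -> domain A y -> A (x - y) = A x - A y.
Proof.
case: linA => _ /(_ (-1) y x) + dx dy => /(_ dy dx)[_].
by rewrite !scaleN1r ![- _ + _]addrC.
Qed.

Lemma domain_gram x : domain (gram A) x -> domain A x.
Proof. by case. Qed.

Lemma rdot_gram x y : domain (gram A) x -> domain A y ->
  rdot (A y) (A x) = rdot y (gram A x).
Proof.
case=> dx [z Az] dy; rewrite /rdot /gram /=.
by case: xgetP => [w _ Aw|/(_ z)//]; rewrite Aw.
Qed.

Lemma closed_op_cvg (u : nat -> H) x (y : K) : closed_op A ->
  (forall k, domain A (u k)) -> u k @[k --> \oo] --> x ->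
  A (u k) @[k --> \oo] --> y -> domain A x /\ A x = y.
Proof.
move=> clA du ux Ay.
suff : graph A (x, y) by case=> /= dx ->.
apply: (@closed_cvg _ _ \oo _ (fun k => (u k, A (u k))) (graph A) clA).
  by apply: nearW => k; split => //=.
exact: cvg_pair.
Qed.

End linear_operator.

Section gram_spectral.
Variables (R : realType) (H K : hilbertType R) (A : operator H K).
Variables (mu : set (measurableTypeR R) -> H -> H).
Hypothesis linA : linear_op A.
Hypothesis closedA : closed_op A.
Hypothesis mu_spectral : is_spectral_measure (gram A) mu.
Implicit Types (x y z : H) (E F : set (measurableTypeR R)).
Implicit Types (s t : {sfun measurableTypeR R >-> R}).

Local Notation si := (simple_integral mu).
Let pvm : projection_valued_measure mu := mu_spectral.1.

Let domain_gramE x : domain (gram A) x = square_integrable mu id x.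
Proof. by case: mu_spectral => _ [->]. Qed.

Let gramE x : domain (gram A) x -> gram A x = spectral_integral mu id x.
Proof. by case: mu_spectral => _ [_]; exact. Qed.

Let measurable_fun_id : measurable_fun setT (id : measurableTypeR R -> R).
Proof. exact: measurable_id. Qed.

Section bounded_support.
Variables (t : {sfun measurableTypeR R >-> R}) (M : R) (x : H).
Hypothesis t1 : forall l, `|t l| <= 1.
Hypothesis tM : forall l, t l != 0 -> `|l| <= M.

Let tM2 (a l : R) : `|a| <= `|l| -> `|a * t l ^+ 2| <= `|M|.
Proof.
move=> al; have [->|tl] := eqVneq (t l) 0; first by rewrite expr0n mulr0 normr0.
rewrite normrM normrX -[leRHS]mulr1 ler_pM ?exprn_ge0//.
  by rewrite (le_trans al)// (le_trans (tM tl))// ler_norm.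
by rewrite expr_le1.
Qed.

Lemma domain_gram_simple_integral : domain (gram A) (si t x).
Proof.
rewrite domain_gramE square_integrableE.
rewrite (integral_simple_integral pvm _ (f := fun l => l ^+ 2)); last 2 first.
- exact: measurable_funX.
- by move=> l; exact: sqr_ge0.
apply: (@le_lt_trans _ _ (\int['m[pvm]_x]_l cst (M ^+ 2)%:E l)%E).
  apply: ge0_le_integral => //.
  - by move=> l _; rewrite lee_fin mulr_ge0 ?sqr_ge0.
  - by apply/measurable_EFinP; apply: measurable_funM; exact: measurable_funX.
  - move=> l _; rewrite /= lee_fin.
    have [->|tl] := eqVneq (t l) 0; first by rewrite expr0n mulr0 sqr_ge0.
    have lM := tM tl; rewrite -[l ^+ 2]real_normK ?num_real//.
    rewrite -[t l ^+ 2]real_normK ?num_real//.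
    have := t1 l; have := normr_ge0 (t l); have := normr_ge0 l => l0 t0 tl1.
    rewrite -[leRHS]mulr1 ler_pM ?exprn_ge0//; last by rewrite expr_le1.
    by rewrite lerXn2r ?nnegrE// (le_trans _ lM).
by rewrite integral_cst//= vector_measureE// -EFinM ltry.
Qed.

Lemma sqnorm_simple_integral_bounded :
  (sqnorm (A (si t x)))%:E = (\int['m[pvm]_x]_l (l * t l ^+ 2)%:E)%E.
Proof.
have dy := domain_gram_simple_integral; set y := si t x in dy *.
rewrite /sqnorm rdot_gram//; last exact: domain_gram.
rewrite gramE//.
have [s [sl scvg]] := sfun_approximation measurable_fun_id.
have ysq : square_integrable mu id y by rewrite -domain_gramE.
have := spectral_integral_cvg pvm measurable_fun_id ysq sl scvg => sy.
have {}sy : ((rdot y (si (s k) y))%:E @[k --> \oo] -->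
    (rdot y (spectral_integral mu id y))%:E)%E.
  by apply: cvg_EFin; [exact: nearW|apply: cvg_rdot => //; exact: cvg_cst].
apply: (cvg_unique (@ereal_hausdorff R) sy).
have -> : (fun k => (rdot y (si (s k) y))%:E) =
    (fun k => \int['m[pvm]_x]_l (s k l * t l ^+ 2)%:E)%E.
  apply/funext => k; rewrite -(rdot_simple_integral pvm) /y.
  rewrite -(rdot_simple_integral pvm) -!(simple_integralM pvm).
  rewrite -(integral_vector_measure pvm).
  apply: eq_integral => l _; congr EFin.
  suff : t l * s k l * t l = s k l * t l ^+ 2 by []; ring.
have [] // := @dominated_convergence _ _ _ 'm[pvm]_x setT measurableT
  (fun k l => (s k l * t l ^+ 2)%:E) (fun l => (l * t l ^+ 2)%:E)
  (EFin \o cst `|M|).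
- move=> k; apply/measurable_EFinP; apply: measurable_funM => //.
  exact: measurable_funX.
- apply/measurable_EFinP; apply: measurable_funM => //.
  exact: measurable_funX.
- apply: nearW => l _; apply: cvg_EFin; first exact: nearW.
  by apply: cvgMl; exact: scvg.
- exact: finite_measure_integrable_cst.
- by apply: nearW => l k _; rewrite lee_fin tM2.
Qed.

End bounded_support.

Lemma pvm_bounded E (M : R) x : measurable E -> (forall l, E l -> `|l| <= M) ->
  domain (gram A) (mu E x) /\
  (sqnorm (A (mu E x)))%:E = (\int['m[pvm]_x]_l (l * \1_E l)%:E)%E.
Proof.
move=> mE EM; pose t := indic_sfun E mE : {sfun measurableTypeR R >-> R}.
have tE l : t l = \1_E l by [].
have t1 l : `|t l| <= 1 by rewrite tE indicE normr_nat lern1 leq_b1.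
have tM l : t l != 0 -> `|l| <= M.
  by rewrite tE indicE pnatr_eq0 eqb0 negbK => /set_mem/EM.
rewrite -(simple_integral_indic pvm _ mE) -/t; split.
  exact: (domain_gram_simple_integral x t1 tM).
rewrite (sqnorm_simple_integral_bounded _ t1 tM).
by apply: eq_integral => l _; rewrite tE indic_sqr.
Qed.

Lemma pvm_negative x : mu (`]-oo, 0[) x = 0.
Proof.
pose F (k : nat) : set (measurableTypeR R) :=
  `[- k.+1%:R, - k.+1%:R^-1]%classic.
have mF k : measurable (F k) by exact: measurable_itv.
have FE k l : F k l -> l < 0.
  rewrite /F /= in_itv/= => /andP[_ /le_lt_trans]; apply.
  by rewrite oppr_lt0 invr_gt0.
have : mu (F k) x @[k --> \oo] --> mu `]-oo, 0[ x.
  apply: (pvm_cvg_set pvm) => // l; rewrite /= in_itv/= => l0.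
  near=> k; rewrite /F /= in_itv/=.
  apply/andP; split.
    rewrite lerNl; near: k; exists (Num.truncn (- l)) => // k /= lk.
    by rewrite (le_trans (ltW (truncnS_gt _)))// ler_nat ltnS.
  rewrite lerNr -[- l]invrK lef_pV2 ?posrE ?invr_gt0 ?oppr_gt0//.
  near: k; exists (Num.truncn (- l)^-1) => // k /= lk.
  by rewrite (le_trans (ltW (truncnS_gt _)))// ler_nat ltnS.
suff -> : (fun k => mu (F k) x) = cst 0.
  move=> z0; apply: (cvg_unique (@norm_hausdorff _ H) z0); exact: cvg_cst.
apply/funext => k /=; apply: sqnorm_eq0.
have Fneg (l : measurableTypeR R) : 0 <= - (l * \1_(F k) l).
  rewrite indicE; have [/set_mem/FE/ltW lk|_] := boolP (l \in F k).
    by rewrite mulr1 oppr_ge0.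
  by rewrite mulr0 oppr0.
have FM l : F k l -> `|l| <= k.+1%:R.
  move=> Fl; rewrite ler0_norm; last exact/ltW/(FE k).
  by move: Fl; rewrite /F /= in_itv/= lerNl => /andP[].
have [_ AF] := pvm_bounded x (mF k) FM.
have negI : (\int['m[pvm]_x]_l (- (l * \1_(F k) l))%:E =
    (- sqnorm (A (mu (F k) x)))%:E)%E.
  rewrite EFinN AF -[LHS]oppeK -integral_ge0N; last first.
    by move=> l _; rewrite lee_fin.
  by congr (- _)%E; apply: eq_integral => l _; rewrite -EFinN opprK.
have : ((k.+1%:R^-1)%:E * 'm[pvm]_x (F k) <=
    \int['m[pvm]_x]_l (- (l * \1_(F k) l))%:E)%E.
  rewrite -[F k in leLHS]setIT -integral_indic// -ge0_integralZl//; last first.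
    exact/measurable_EFinP.
  apply: ge0_le_integral => //.
  - by apply: measurable_funeM; exact/measurable_EFinP.
  - apply/measurable_EFinP; apply: measurableT_comp => //.
    exact: measurable_funM.
  - move=> l _; rewrite -EFinM lee_fin indicE.
    have [/set_mem|_] := boolP (l \in F k); last by rewrite !mulr0 oppr0.
    by rewrite /F /= in_itv/= !mulr1 => /andP[_]; rewrite lerNr.
rewrite negI vector_measureE// -EFinM lee_fin => le0.
have := sqnorm_ge0 (A (mu (F k) x)); have := sqnorm_ge0 (mu (F k) x) => q0 s0.
have : k.+1%:R^-1 * sqnorm (mu (F k) x) <= 0.
  by apply: (le_trans le0); rewrite oppr_le0.
by rewrite pmulr_rle0 ?invr_gt0// => q0'; apply/eqP; rewrite eq_le q0' q0.
Unshelve. all: by end_near. Qed.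

Local Notation E_ k := (`[0, k%:R]%classic : set (measurableTypeR R)).

Let bounded_initial k (l : R) : E_ k l -> `|l| <= k%:R.
Proof. by rewrite /= in_itv/= => /andP[l0 lk]; rewrite ger0_norm. Qed.

Let initial_near (l : R) : 0 <= l -> \forall k \near \oo, E_ k l.
Proof.
move=> l0; exists (Num.truncn l).+1 => // k /= lk; rewrite in_itv/= l0/=.
by rewrite (le_trans (ltW (truncnS_gt _)))// ler_nat.
Qed.

Lemma pvm_nonnegative x : mu `[0, +oo[ x = x.
Proof.
rewrite -[X in mu X]setCK (pvm_setC pvm); last exact: measurableC.
rewrite (_ : ~` _ = `]-oo, 0[%classic); last first.
  by rewrite setCitvr.
by rewrite pvm_negative subr0.
Qed.

Lemma pvm_initial_cvg x : mu (E_ k) x @[k --> \oo] --> x.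
Proof.
rewrite -[x in _ --> x]pvm_nonnegative.
apply: (pvm_cvg_set pvm) => // [k l|l] /=.
- by rewrite !in_itv/= andbT => /andP[].
- by rewrite in_itv/= andbT; exact: initial_near.
Qed.

Lemma gram_pvm E (M : R) x : measurable E -> (forall l, E l -> `|l| <= M) ->
  gram A (mu E x) = mu E (gram A (mu E x)).
Proof.
move=> mE EM; have [dy _] := pvm_bounded x mE EM.
rewrite !gramE//.
have [s [sl scvg]] := sfun_approximation measurable_fun_id.
have ysq : square_integrable mu id (mu E x) by rewrite -domain_gramE.
have sy := spectral_integral_cvg pvm measurable_fun_id ysq sl scvg.
apply: (cvg_unique (@norm_hausdorff _ H) sy).
have /= := pvm_cvg pvm mE sy.
have -> // : (fun k => mu E (si (s k) (mu E x))) = (fun k => si (s k) (mu E x)).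
apply/funext => k; rewrite -!(simple_integral_indic pvm _ mE).
have tst : indic_sfun E mE * s k * indic_sfun E mE = s k * indic_sfun E mE.
  apply/sfuneqP => l; suff : \1_E l * s k l * \1_E l = s k l * \1_E l by [].
  by rewrite mulrAC -expr2 indic_sqr mulrC.
by rewrite -!(simple_integralM pvm) tst.
Qed.

Lemma sqnorm_pvm_bounded_le E (M : R) x : measurable E ->
  (forall l, E l -> `|l| <= M) -> domain A x ->
  sqnorm (A (mu E x)) <= sqnorm (A x).
Proof.
move=> mE EM dx; have [dy _] := pvm_bounded x mE EM.
have rE : rdot (A x) (A (mu E x)) = sqnorm (A (mu E x)).
  rewrite /sqnorm !rdot_gram//; last exact: domain_gram.
  by rewrite [RHS](rdot_pvm pvm)// -(gram_pvm x mE EM).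
by have := sqnorm_ge0 (A x - A (mu E x)); rewrite sqnormB rE; lra.
Qed.

Lemma domain_square_integrable x : domain A x ->
  square_integrable mu (@sqrt_nneg R) x.
Proof.
move=> dx; rewrite (square_integrableE pvm).
apply: (@le_lt_trans _ _ (sqnorm (A x))%:E); last exact: ltry.
have mono : (\int['m[pvm]_x]_l (l * \1_(E_ k) l)%:E @[k --> \oo] -->
    \int['m[pvm]_x]_l (sqrt_nneg l ^+ 2)%:E)%E.
  have ge0 k (l : R) : 0 <= l * \1_(E_ k) l.
    rewrite indicE; have [/set_mem/=|_] := boolP (l \in _); last first.
      by rewrite mulr0.
    by rewrite in_itv/= => /andP[l0 _]; rewrite mulr1.
  have /= := @cvg_monotone_convergence _ _ _ 'm[pvm]_x setT measurableT
    (fun k l => (l * \1_(E_ k) l)%:E).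
  under [X in _ -> _ -> _ -> _ --> X]eq_integral => l _.
    rewrite (_ : limn _ = (sqrt_nneg l ^+ 2)%:E); last first.
      apply/cvg_lim => //; apply: cvg_near_cst.
      rewrite sqrt_nneg_sqr; have [l0|l0] := leP 0 l.
        apply: filterS (initial_near l0) => k Ekl; rewrite !indicE !mem_set//=.
        by rewrite in_itv/= l0.
      apply: nearW => k; rewrite !indicE !memNset//=;
        by rewrite in_itv/= ?andbT leNgt l0.
    over.
  apply=> //.
  - by move=> k; apply/measurable_EFinP; apply: measurable_funM.
  - by move=> k l _; rewrite lee_fin.
  - move=> l _ j k jk; rewrite lee_fin !indicE.
    have [/set_mem/=|_] := boolP (l \in E_ j).
      rewrite in_itv/= => /andP[l0 lj]; rewrite mem_set//= in_itv/= l0/=.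
      by rewrite (le_trans lj)// ler_nat.
    by rewrite mulr0 -indicE.
apply: (cvge_to_le mono); apply: nearW => k.
have mE : measurable (E_ k) by [].
have [_ <-] := pvm_bounded x mE (@bounded_initial k).
by rewrite lee_fin; exact: (sqnorm_pvm_bounded_le mE (@bounded_initial k) dx).
Qed.

Let initial_sqnormB j k x :
  (sqnorm (A (mu (E_ j) x) - A (mu (E_ k) x)))%:E =
  (\int['m[pvm]_x]_l
     ((sqrt_nneg l * \1_(E_ j) l - sqrt_nneg l * \1_(E_ k) l) ^+ 2)%:E)%E.
Proof.
have mj : measurable (E_ j) by []; have mk : measurable (E_ k) by [].
have [dj _] := pvm_bounded x mj (@bounded_initial j).
have [dk _] := pvm_bounded x mk (@bounded_initial k).
rewrite -linear_opB//; [|exact: domain_gram..].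
rewrite -(simple_integral_indic pvm _ mj) -(simple_integral_indic pvm _ mk).
rewrite -(simple_integralB pvm).
set t := indic_sfun _ mj - indic_sfun _ mk : {sfun measurableTypeR R >-> R}.
have tE l : t l = \1_(E_ j) l - \1_(E_ k) l by [].
have t1 l : `|t l| <= 1.
  rewrite tE !indicE; case: (l \in _); case: (l \in _);
  by rewrite ?subrr ?subr0 ?sub0r ?normrN ?normr0 ?normr1 ?ler01.
have tM l : t l != 0 -> `|l| <= Num.max j%:R k%:R.
  rewrite tE !indicE le_max.
  have [/set_mem/bounded_initial ->//|_] := boolP (l \in E_ j).
  have [/set_mem/bounded_initial ->|_] := boolP (l \in E_ k).
    by rewrite orbT.
  by rewrite subrr eqxx.
rewrite (sqnorm_simple_integral_bounded x t1 tM).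
apply: eq_integral => l _; congr EFin.
rewrite -mulrBr exprMn tE sqrt_nneg_sqr; have [l0|l0] := leP 0 l.
  by rewrite [\1_(`[0, +oo[) _]indicE mem_set ?mulr1//= in_itv/= l0.
have neg i : \1_(E_ i) l = 0 :> R.
  by rewrite indicE memNset//= in_itv/= leNgt l0.
by rewrite !neg subrr expr0n !mulr0.
Qed.

Lemma domain_of_square_integrable x : square_integrable mu (@sqrt_nneg R) x ->
  domain A x /\ A (mu (E_ k) x) @[k --> \oo] --> A x.
Proof.
move=> xsq; have int := xsq; rewrite (square_integrableE pvm) in int.
pose u k (l : measurableTypeR R) := sqrt_nneg l * \1_(E_ k) l.
have mu_ k : measurable_fun setT (u k).
  by apply: measurable_funM => //; exact: measurable_sqrt_nneg.
have uf k l : `|u k l| <= `|sqrt_nneg l|.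
  rewrite normrM indicE normr_nat; case: (l \in _); first by rewrite mulr1.
  by rewrite mulr0.
have ucvg l : u k l @[k --> \oo] --> sqrt_nneg l.
  apply: cvg_near_cst; have [l0|l0] := leP 0 l.
    apply: filterS (initial_near l0) => k Ekl.
    by rewrite /u indicE mem_set// mulr1.
  by apply: nearW => k; rewrite /u sqrt_nnegE ltr0_sqrtr// mul0r.
have dk k : domain A (mu (E_ k) x).
  have mk : measurable (E_ k) by [].
  have [+ _] := pvm_bounded x mk (@bounded_initial k).
  exact: domain_gram.
have [e e0|z Az] := @cauchy_sqnorm _ _ (fun k => A (mu (E_ k) x)).
  have [N uN] := square_dominated_cauchy (@measurable_sqrt_nneg R) int
    mu_ mu_ uf uf ucvg ucvg e0.
  by exists N => j k Nj Nk; rewrite -lte_fin initial_sqnormB uN.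
by have [? ->] := closed_op_cvg closedA dk (@pvm_initial_cvg x) Az.
Qed.

Lemma domain_opE : domain A = square_integrable mu (@sqrt_nneg R).
Proof.
apply/seteqP; split=> x; first exact: domain_square_integrable.
by case/domain_of_square_integrable.
Qed.

Lemma kernel_gramP x : Defs.kernel (gram A) x <-> mu [set 0] x = x.
Proof.
have m0 : measurable ([set 0] : set (measurableTypeR R)) by [].
split=> [[dx Sx]|x0].
- have xsq : square_integrable mu id x by rewrite -domain_gramE.
  have := sqnorm_spectral_integral pvm measurable_fun_id xsq.
  rewrite -gramE// Sx sqnorm0 => /esym int0.
  have mC : measurable (~` [set 0] : set (measurableTypeR R)).
    exact: measurableC.
  suff : mu (~` [set 0]) x = 0.
    by rewrite (pvm_setC pvm)// => /eqP; rewrite subr_eq0 => /eqP.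
  apply: sqnorm_eq0; apply: EFin_inj; rewrite -(vector_measureE pvm)//.
  have msq : measurable_fun setT (fun l : measurableTypeR R => (l ^+ 2)%:E).
    by apply/measurable_EFinP; exact: measurable_funX.
  have [/(_ _) ae0 _] := ae_eq_integral_abs 'm[pvm]_x measurableT msq.
  apply: measure_negligible => //; apply: negligibleS (ae0 _).
    by move=> l /= l0 /(_ Logic.I)[/eqP]; rewrite sqrf_eq0 => /eqP.
  by under eq_integral do rewrite gee0_abs ?lee_fin ?sqr_ge0//.
- have E0 (l : measurableTypeR R) : [set 0] l -> `|l| <= 0.
    by move=> ->; rewrite normr0.
  have [dx _] := pvm_bounded x m0 E0; rewrite x0 in dx.
  split=> //; rewrite gramE//.
  have xsq : square_integrable mu id x by rewrite -domain_gramE.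
  have [s [sl scvg]] := sfun_approximation measurable_fun_id.
  have sx := spectral_integral_cvg pvm measurable_fun_id xsq sl scvg.
  apply: (cvg_unique (@norm_hausdorff _ H) sx).
  apply: cvg_near_cst; apply: nearW => k.
  rewrite -[in LHS]x0 -(simple_integral_indic pvm _ m0) -(simple_integralM pvm).
  apply: (simple_integral_eq0 pvm) => l.
  suff : s k l * \1_[set 0] l = 0 :> R by [].
  rewrite indicE; have [/set_mem/= ->|_] := boolP (l \in _); last first.
    by rewrite mulr0.
  have := sl k 0; rewrite normr0 normr_le0 => /eqP ->; exact: mul0r.
Qed.

Let m0 : measurable ([set 0] : set (measurableTypeR R)).
Proof. exact: measurable_set1. Qed.

Lemma orthocomplement_kernel_gram x : mu [set 0] x = 0 ->
  orthocomplement (Defs.kernel (gram A)) x.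
Proof.
move=> x0 y /(kernel_gramP) <-.
by rewrite -(inner_pvm pvm)// x0 linear0l.
Qed.

Lemma kernel_projectionE x : kernel_projection A x = mu [set 0] x.
Proof.
rewrite /kernel_projection /orthogonal_projection.
case: xgetP => [p _ [Np xp]|/(_ (mu [set 0] x))[]]; last first.
  split; first by apply/(kernel_gramP); rewrite (pvm_idem pvm).
  apply: orthocomplement_kernel_gram.
  by rewrite (pvmB pvm)// (pvm_idem pvm)// subrr.
have p0 := (kernel_gramP p).1 Np.
have N0 : Defs.kernel (gram A) (mu [set 0] (x - p)).
  by apply/(kernel_gramP); rewrite (pvm_idem pvm).
have : mu [set 0] (x - p) = 0.
  by apply: sqnorm_eq0; rewrite -rdot_pvm_self// rdotC /rdot xp.
by rewrite (pvmB pvm)// p0 => /eqP; rewrite subr_eq0 => /eqP.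
Qed.

Lemma op_kernel_gram x : Defs.kernel (gram A) x -> domain A x /\ A x = 0.
Proof.
case=> dx Sx; have dAx := domain_gram dx; split=> //; apply: sqnorm_eq0.
by rewrite /sqnorm rdot_gram// Sx rdotC rdot0l.
Qed.

Lemma pvm_positive x : mu `]0, +oo[ x = x - mu [set 0] x.
Proof.
rewrite -[x in x - _]pvm_nonnegative.
rewrite (_ : `[0, +oo[%classic = [set 0] `|` `]0, +oo[%classic); last first.
  by rewrite setU1itv.
rewrite (pvm_setU pvm)//; first by rewrite addrAC subrr add0r.
by rewrite -subset0 => l [/= ->]; rewrite in_itv/= ltxx.
Qed.

Lemma sqnorm_simple_integral_le s t x : (forall l, `|s l| <= `|t l|) ->
  sqnorm (si s x) <= sqnorm (si t x).
Proof.
move=> st; rewrite -lee_fin -!(integral_vector_measure_sqr pvm).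
apply: ge0_le_integral => //.
- by move=> l _; rewrite lee_fin sqr_ge0.
- by apply/measurable_EFinP; exact: measurable_funX.
- by apply/measurable_EFinP; exact: measurable_funX.
- move=> l _; rewrite lee_fin -[leLHS]real_normK ?num_real//.
  by rewrite -[leRHS]real_normK ?num_real// lerXn2r ?nnegrE.
Qed.

Section approximation.
Variables (x : H) (dx : domain A x).
Variables (Qt : H -> K) (Qt_ext : is_isometric_extension A mu Qt).
Variable s : nat -> {nnsfun measurableTypeR R >-> R}.
Hypothesis nds : forall l, nondecreasing_seq (fun k => s k l).
Hypothesis s_cvg : forall l, s k l @[k --> \oo] --> sqrt_nneg l.

Let v k := si (s k) x.
Let r k (l : measurableTypeR R) := inv_sqrt l * s k l.
Let u k := spectral_integral mu (@inv_sqrt R) (v k).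

Let xsq : square_integrable mu (@sqrt_nneg R) x.
Proof. by rewrite -domain_opE. Qed.

Let s_ge0 k l : 0 <= s k l. Proof. exact: fun_ge0. Qed.

Let s_le k l : s k l <= sqrt_nneg l.
Proof. exact: (nondecreasing_cvg_ge0_le (nds l) (@s_cvg l) k). Qed.

Let inv_sqrt_ge0 (l : R) : 0 <= inv_sqrt l.
Proof. by rewrite inv_sqrtE invr_ge0 sqrtr_ge0. Qed.

Let r_ge0 k l : 0 <= r k l.
Proof. by rewrite mulr_ge0. Qed.

Let r_le k l : r k l <= \1_(`]0, +oo[) l.
Proof.
rewrite /r {1}/inv_sqrt indicE.
have [/set_mem/=|_] := boolP (l \in _); last first.
  by rewrite mulr0 mul0r.
rewrite in_itv/= andbT => l0; rewrite mulr1 mulrC ler_pdivrMr ?sqrtr_gt0//.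
by rewrite mul1r -sqrt_nnegE.
Qed.

Let r_le1 k l : r k l <= 1.
Proof. by apply: (le_trans (r_le k l)); rewrite indicE lern1 leq_b1. Qed.

Let measurable_r k : measurable_fun setT (r k).
Proof. by apply: measurable_funM => //; exact: measurable_inv_sqrt. Qed.

Let r_cvg l : r k l @[k --> \oo] --> (\1_(`]0, +oo[) l : R).
Proof.
rewrite (_ : \1_ _ _ = inv_sqrt l * sqrt_nneg l); first exact: cvgMr.
rewrite inv_sqrtE sqrt_nnegE indicE; have [l0|l0] := ltP 0 l.
  by rewrite mem_set ?mulVf ?gt_eqF ?sqrtr_gt0//= in_itv/= l0.
by rewrite ler0_sqrtr// mulr0 memNset//= in_itv/= andbT ltNge l0.
Qed.

Let v_inv_sqrt k : square_integrable mu (@inv_sqrt R) (v k).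
Proof.
rewrite (square_integrableE pvm) (integral_simple_integral pvm _
  (f := fun l => inv_sqrt l ^+ 2)); last 2 first.
- by apply: measurable_funX; exact: measurable_inv_sqrt.
- by move=> l; exact: sqr_ge0.
apply: (@le_lt_trans _ _ (\int['m[pvm]_x]_l cst 1%E l)%E); last first.
  by rewrite integral_cst//= vector_measureE// mul1e ltry.
apply: ge0_le_integral => //.
- by move=> l _; rewrite -exprMn lee_fin sqr_ge0.
- apply/measurable_EFinP; apply: measurable_funM; apply: measurable_funX => //.
  exact: measurable_inv_sqrt.
- move=> l _; rewrite -exprMn lee_fin -[_ * _]/(r k l).
  by rewrite expr_le1.
Qed.

Let u_approx k : exists t : nat -> {sfun measurableTypeR R >-> R},
  [/\ forall j l, `|(t j * s k) l| <= r k l,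
      forall l, (t j * s k) l @[j --> \oo] --> r k l
    & si (t j * s k) x @[j --> \oo] --> u k].
Proof.
have [t [tf tcvg]] := sfun_approximation (@measurable_inv_sqrt R).
have tu := spectral_integral_cvg pvm (@measurable_inv_sqrt R)
  (v_inv_sqrt k) tf tcvg.
exists t; split=> [j l|l|].
- suff : `|t j l * s k l| <= r k l by [].
  rewrite normrM (ger0_norm (s_ge0 _ _)) ler_wpM2r//.
  by rewrite (le_trans (tf j l))// ger0_norm.
- suff : t j l * s k l @[j --> \oo] --> r k l by [].
  by apply: cvgMl; exact: tcvg.
- by under eq_fun do rewrite (simple_integralM pvm).
Qed.

Let u_domain k : domain A (u k).
Proof.
rewrite domain_opE (square_integrableE pvm).
have := xsq; rewrite (square_integrableE pvm); apply: le_lt_trans.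
apply: ge0_le_measure_integral => //; last 2 first.
- by move=> l; rewrite lee_fin sqr_ge0.
- apply/measurable_EFinP; apply: measurable_funX.
  exact: measurable_sqrt_nneg.
move=> E mE; rewrite /= !vector_measureE// lee_fin.
have [t [tr _ tu]] := u_approx k.
have /cvg_sqnorm := pvm_cvg pvm mE tu.
move=> /cvgr_to_le; apply; apply: nearW => j.
rewrite -!(simple_integral_indic pvm _ mE) -(simple_integralM pvm).
apply: sqnorm_simple_integral_le => l.
suff : `|\1_E l * (t j * s k) l| <= `|\1_E l| by [].
by rewrite normrM ler_piMr// (le_trans (tr j l)).
Qed.

Let v_kernel k : mu [set 0] (v k) = 0.
Proof.
rewrite -(simple_integral_indic pvm _ m0) -(simple_integralM pvm).
apply: (simple_integral_eq0 pvm) => l.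
suff : \1_[set 0] l * s k l = 0 :> R by [].
rewrite indicE; have [/set_mem/= ->|_] := boolP (l \in _); last first.
  by rewrite mul0r.
have := s_le k 0; rewrite sqrt_nnegE sqrtr0 => s0.
by rewrite (_ : s k 0 = 0) ?mulr0//; apply/eqP; rewrite eq_le s0 s_ge0.
Qed.

Let Q_v k : partial_isometry A Qt (v k) = A (u k).
Proof.
rewrite /partial_isometry kernel_projectionE v_kernel subr0.
case: Qt_ext => _ _ -> //; first exact: orthocomplement_kernel_gram.
by split; [exact: v_inv_sqrt|exact: u_domain].
Qed.

Let sqnorm_AuB j k : sqnorm (A (u j) - A (u k)) = sqnorm (v j - v k).
Proof.
rewrite -!Q_v /partial_isometry !kernel_projectionE !v_kernel !subr0.
have Mv i : orthocomplement (Defs.kernel (gram A)) (v i).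
  exact: orthocomplement_kernel_gram.
have Mvjk : orthocomplement (Defs.kernel (gram A)) (v j - v k).
  by apply: orthocomplement_kernel_gram; rewrite (pvmB pvm)// !v_kernel subrr.
case: Qt_ext => Qlin Qiso _.
have -> : Qt (v j) - Qt (v k) = Qt (v j - v k).
  by rewrite addrC -scaleN1r -Qlin// scaleN1r addrC.
by apply: complexI; rewrite -!sqnormE Qiso.
Qed.

Let v_cvg : v k @[k --> \oo] --> spectral_integral mu (@sqrt_nneg R) x.
Proof.
apply: (spectral_integral_cvg pvm (@measurable_sqrt_nneg R) xsq) => // k l.
have sqrt0 : 0 <= sqrt_nneg l by rewrite sqrt_nnegE sqrtr_ge0.
by rewrite !ger0_norm// s_le.
Qed.

Let u_cvg : u k @[k --> \oo] --> mu `]0, +oo[ x.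
Proof.
have mP : measurable (`]0, +oo[%classic : set (measurableTypeR R)) by [].
pose one := (\1_(`]0, +oo[) : measurableTypeR R -> R).
have mone : measurable_fun setT one by exact: measurable_indic.
have one2 : (\int['m[pvm]_x]_l (one l ^+ 2)%:E < +oo)%E.
  under eq_integral do rewrite indic_sqr; rewrite integral_indic// setIT /=.
  by rewrite vector_measureE// ltry.
apply/cvg_sqnormP => e e0; have e16 : 0 < e / 16 by rewrite divr_gt0.
have r_one k l : `|r k l| <= `|one l|.
  by rewrite !ger0_norm// (le_trans (r_ge0 k l)) ?r_le.
have [N1 N1P] := square_dominated_cauchy mone one2 (fun=> mone) measurable_r
  (fun k l => lexx _) r_one
  (fun l => cvg_cst _) r_cvg e16.
exists N1 => // k /= N1k.
have [t [tr tcvg tu]] := u_approx k.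
have r2 : (\int['m[pvm]_x]_l (r k l ^+ 2)%:E < +oo)%E.
  apply: le_lt_trans one2; apply: ge0_le_integral => //.
  - by move=> l _; rewrite lee_fin sqr_ge0.
  - by apply/measurable_EFinP; exact: measurable_funX.
  - by apply/measurable_EFinP; exact: measurable_funX.
  - by move=> l _; rewrite lee_fin lerXn2r ?nnegrE ?r_le.
have [N2 N2P] := square_dominated_cauchy (measurable_r k) r2
  (fun=> measurable_r k) (fun j => measurable_sfun (t j * s k))
  (fun j l => lexx _) (fun j l => le_trans (tr j l) (ler_norm _))
  (fun l => cvg_cst _) tcvg e16.
move/cvg_sqnormP : tu => /(_ _ e16)[N3 _ N3P].
pose j := maxn N2 N3; have N2j : (N2 <= j)%N := leq_maxl _ _.
have xt : sqnorm (mu `]0, +oo[ x - si (t j * s k) x) < e / 4.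
  rewrite -(simple_integral_indic pvm _ mP) -lte_fin.
  rewrite (sqnorm_simple_integralB pvm).
  apply: (le_lt_trans (integral_sqrB_le 'm[pvm]_x (measurable_r k) mone
    (measurable_sfun (t j * s k)))).
  have -> : (e / 4)%:E = (2%:E * (e / 16)%:E + 2%:E * (e / 16)%:E)%E.
    by rewrite -!EFinM -EFinD; congr EFin; field.
  apply: lteD; rewrite lte_pmul2l//; first exact: N1P.
  have := N2P j j N2j N2j; congr (_ < _)%E; apply: eq_integral => l _.
  by congr EFin; ring.
rewrite -(subrKA (si (t j * s k) x)); apply: (le_lt_trans (sqnormD_le _ _)).
have := N3P j (leq_maxr _ _); rewrite /= sqnormBC; lra.
Qed.

Lemma partial_isometry_simple_cvg :
  partial_isometry A Qt (si (s k) x) @[k --> \oo] --> A x.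
Proof.
have [e e0|z Auz] := @cauchy_sqnorm _ _ (fun k => A (u k)).
  have e4 : 0 < e / 4 by rewrite divr_gt0.
  move/cvg_sqnormP : v_cvg => /(_ _ e4)[N _ vN].
  exists N => j k Nj Nk; rewrite sqnorm_AuB.
  rewrite -(subrKA (spectral_integral mu (@sqrt_nneg R) x)).
  apply: (le_lt_trans (sqnormD_le _ _)); rewrite sqnormBC.
  have := vN j Nj; have := vN k Nk; rewrite /=; lra.
have [dp Ap] := closed_op_cvg closedA u_domain u_cvg Auz.
have [d0 A0] : domain A (mu [set 0] x) /\ A (mu [set 0] x) = 0.
  apply: op_kernel_gram; apply/(kernel_gramP).
  by rewrite (pvm_idem pvm).
have -> : A x = z.
  by rewrite -Ap pvm_positive (linear_opB linA)// A0 subr0.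
by under eq_fun do rewrite -/(v _) Q_v.
Qed.

End approximation.
End gram_spectral.

Theorem corollary3p11 (R : realType) (H K : hilbertType R)
    (sepH : separable H) (sepK : separable K)
    (A : operator H K)
    (linA : linear_op A) (closedA : closed_op A) (denseA : densely_defined A)
    (mu : set (measurableTypeR R) -> H -> H)
    (mu_spectral : is_spectral_measure (gram A) mu)
    (Qt : H -> K) (Qt_ext : is_isometric_extension A mu Qt) :
  let Q := partial_isometry A Qt in
  op_eq A (nu_integral A mu Q (@sqrt_nneg R)).
Proof.
move=> Q; have pvm := mu_spectral.1.
have mC : measurable (~` [set 0] : set (measurableTypeR R)).
  exact: measurableC.
split=> [|x dx] /=.
  rewrite (domain_opE linA closedA mu_spectral).
  apply/funext => x; rewrite /mkset (kernel_projectionE mu_spectral).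
  rewrite -(pvm_setC pvm)// !(square_integrableE pvm).
  rewrite -(simple_integral_indic pvm _ mC).
  rewrite (integral_simple_integral pvm _ (f := fun l => sqrt_nneg l ^+ 2)).
  - congr (is_true (_ < _)%E); apply: eq_integral => l _; congr EFin.
    suff : sqrt_nneg l ^+ 2 = sqrt_nneg l ^+ 2 * \1_(~` [set 0]) l ^+ 2 by [].
    rewrite indic_sqr indicE; have [->|/eqP l0] := eqVneq l 0.
      by rewrite sqrt_nnegE sqrtr0 expr0n mul0r.
    by rewrite mem_set ?mulr1.
  - by apply: measurable_funX; exact: measurable_sqrt_nneg.
  - by move=> l; exact: sqr_ge0.
have Ax := partial_isometry_simple_cvg linA closedA mu_spectral dx Qt_ext.
have sqrt_ge0 (l : R) : 0 <= sqrt_nneg l by rewrite sqrt_nnegE sqrtr_ge0.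
case: xgetP => [y _ yP|/(_ (A x))[] s nds scvg]; last exact: Ax.
have [s [nds scvg]] := nnsfun_approximation (@measurable_sqrt_nneg R) sqrt_ge0.
apply: (cvg_unique (@norm_hausdorff _ K) (Ax s nds scvg)).
exact: yP.
Qed.
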